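(* For any integer $k\ge0$, define the linear functionals $\lambda^k_i$, $i=1,\ldots,n$, on functions $f$ on $[a,b]$ by $$\lambda^k_if=(\Delta^{k+1}_nf)(x_i),\quad i=1,\ldots,k+1,$$ $$\lambda^k_if=(\Delta^{k+1}_nf)(x_i)\cdot\frac{x_i-x_{i-k-1}}{k+1},\quad i=k+2,\ldots,n.$$ Then $\lambda^k_1,\ldots,\lambda^k_n$ is a dual basis to the $k$th degree falling factorial basis $h^k_1,\ldots,h^k_n$, in the sense that for all $i,j\in\{1,\ldots,n\}$, $\lambda^k_ih^k_j=1$ if $i=j$ and $\lambda^k_ih^k_j=0$ otherwise.
   Context: Design points: $a\le x_1<\cdots<x_n\le b$ with $n\ge k+1$, and $x_{n+1}=b$. Empty products equal 1. Divided differences: $f[z]=f(z)$ and $f[z_1,\ldots,z_{r+1}]=(f[z_2,\ldots,z_{r+1}]-f[z_1,\ldots,z_r])/(z_{r+1}-z_1)$ for distinct points. Discrete derivatives, for $d\ge1$: $(\Delta^d_nf)(x)=d!\,f[x_{i-d+1},\ldots,x_i,x]$ if $x\in(x_i,x_{i+1}]$, $i\ge d$; $(\Delta^d_nf)(x)=i!\,f[x_1,\ldots,x_i,x]$ if $x\in(x_i,x_{i+1}]$, $1\le i<d$; $(\Delta^d_nf)(x)=f(x)$ if $x\le x_1$. Falling factorial basis: $h^k_j(x)=\frac1{(j-1)!}\prod_{\ell=1}^{j-1}(x-x_\ell)$ for $j=1,\ldots,k+1$, and $h^k_j(x)=\frac1{k!}\prod_{\ell=j-k}^{j-1}(x-x_\ell)\cdot1\{x>x_{j-1}\}$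 for $j=k+2,\ldots,n$. *)

(* Defs.v *)
From mathcomp Require Import all_boot all_order all_algebra.
From mathcomp Require Import reals.

Set Implicit Arguments.
Unset Strict Implicit.
Unset Printing Implicit Defensive.

Import Order.TTheory GRing.Theory Num.Theory.
Local Open Scope ring_scope.

Section FallingFactorial.
Variable R : realType.

(* [divdiff_rec f r s] is the divided difference of [f] at the first [r.+1]
   entries of [s]. *)
Fixpoint divdiff_rec (f : R -> R) (r : nat) (s : seq R) : R :=
  if r is r'.+1 then
    (divdiff_rec f r' (behead s) - divdiff_rec f r' s) / (s`_r - s`_0)
  else f s`_0.

Definition divdiff (f : R -> R) (s : seq R) : R :=
  divdiff_rec f (size s).-1 s.

(* The design points are x 1, ..., x n, and x n.+1 stands for the right
   endpoint b; x 0 is never used.  For strictly increasing x at most one i can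
   be picked; the value 0 in the last branch is only reached for t > x n.+1,
   i.e. outside [a, b]. *)
Definition discrete_deriv (n : nat) (x : nat -> R) (d : nat)
    (f : R -> R) (t : R) : R :=
  if t <= x 1%N then f t
  else if [pick i : 'I_n.+1 | (1 <= i)%N && (x i < t <= x i.+1)] is Some i then
    if (d <= i)%N then
      d`!%:R * divdiff f (rcons [seq x l | l <- index_iota (i - d).+1 i.+1] t)
    else
      i`!%:R * divdiff f (rcons [seq x l | l <- index_iota 1 i.+1] t)
  else 0.

Definition ff_basis (x : nat -> R) (k j : nat) (t : R) : R :=
  if (j <= k.+1)%N then
    (j.-1)`!%:R^-1 * \prod_(1 <= l < j) (t - x l)
  else
    k`!%:R^-1 * \prod_(j - k <= l < j) (t - x l) * (x j.-1 < t)%R%:R.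

Definition ff_dual (n : nat) (x : nat -> R) (k i : nat) (f : R -> R) : R :=
  if (i <= k.+1)%N then
    discrete_deriv n x k.+1 f (x i)
  else
    discrete_deriv n x k.+1 f (x i) * ((x i - x (i - k.+1)%N) / k.+1%:R).

End FallingFactorial.

(* Main.v *)
Require Import Defs.
From mathcomp Require Import all_boot all_order all_algebra.
From mathcomp Require Import reals.
From mathcomp Require Import zify ring.
Set Implicit Arguments.
Unset Strict Implicit.
Unset Printing Implicit Defensive.
Import Order.TTheory GRing.Theory Num.Theory.
Local Open Scope ring_scope.

(** At a design point [x_i] with [i >= 2] the index picked by the discrete
    derivative is [i-1], so every functional is expressed by divided
    differences at consecutive design points: [(i-1)! f[x_1, ..., x_i]] for
    [i <= k+1], and, since the factor [x_i - x_(i-k-1)] cancels the last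
    denominator of the recursion,
    [k! (f[x_(i-k), ..., x_i] - f[x_(i-k-1), ..., x_(i-1)])] for [i >= k+2]
    ([ff_dualE]).  Linearity and locality are then inherited from divided
    differences.

    For duality put [q = min (j-1, k)].  The basis function [h_j] vanishes at
    [x_i] for [i < j] ([ff_basis_eq0]), and for [i >= j-q] it agrees at [x_i]
    with [1/q!] times the monic polynomial with roots [x_(j-q), ..., x_(j-1)]
    ([ff_basisE]): where the indicator is 0 in this range, the polynomial
    vanishes anyway.  A divided difference of order [r >= q] of a monic
    polynomial of degree [q] is 1 if [q = r] and 0 otherwise
    ([divdiff_rec_prod_sub]).  Consequently the divided difference of [h_j] is
    0 if the block of nodes ends before [x_j], and [(q == r) / q!] if the block
    has order [r >= q] and starts at [x_(j-q)] or later; every block that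
    occurs is of one of these two kinds.  For [i <= k+1] this is duality of the
    Newton basis; for [i >= k+2] the two blocks in the difference end at [x_i]
    and [x_(i-1)], and their contributions cancel unless the first reaches
    [x_j] and the second does not, that is, unless [i = j]. *)

(** * Divided differences of monic polynomials given by their roots *)

Section DividedDifferences.
Variable R : realType.
Implicit Types (f g : R -> R) (r : nat) (s : seq R).

Lemma divdiff_recS f r s :
  divdiff_rec f r.+1 s =
  (divdiff_rec f r (behead s) - divdiff_rec f r s) / (s`_r.+1 - s`_0).
Proof. by []. Qed.

Lemma eq_divdiff_rec f g r s :
  (forall l, (l <= r)%N -> f s`_l = g s`_l) ->
  divdiff_rec f r s = divdiff_rec g r s.
Proof.
elim: r s => [|r IHr] s fg /=; first exact: fg.
rewrite (IHr (behead s)) ?(IHr s) // => l lr; first by apply: fg; lia.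
by rewrite nth_behead; apply: fg; lia.
Qed.

Lemma divdiff_recP f g c r s :
  divdiff_rec (fun t => c * f t + g t) r s =
  c * divdiff_rec f r s + divdiff_rec g r s.
Proof. by elim: r s => //= r IHr s; rewrite !IHr; ring. Qed.

Lemma divdiff_rec0 r s : divdiff_rec (fun=> 0 : R) r s = 0.
Proof. by elim: r s => //= r IHr s; rewrite !IHr subrr mul0r. Qed.

Lemma divdiff_recZ f c r s :
  divdiff_rec (fun t => c * f t) r s = c * divdiff_rec f r s.
Proof.
rewrite -[RHS]addr0 -(divdiff_rec0 r s) -divdiff_recP.
by apply: eq_divdiff_rec => l _; rewrite addr0.
Qed.

Lemma divdiff_rec1 r s : divdiff_rec (fun=> 1 : R) r s = (r == 0)%N%:R.
Proof.
by elim: r s => //= r IHr s; rewrite !IHr subrr mul0r.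
Qed.

(** The Leibniz rule for a linear factor, whose higher divided differences
    vanish.  In the inductive step the block without its first node should
    split off the factor at its last node rather than at its first one; the
    recursion for [g] on that block converts one form into the other. *)
Lemma divdiff_rec_mul_sub g c r s : uniq s -> (r.+1 < size s)%N ->
  divdiff_rec (fun t => (t - c) * g t) r.+1 s =
  (s`_0 - c) * divdiff_rec g r.+1 s + divdiff_rec g r (behead s).
Proof.
have neq r' s' : uniq s' -> (r'.+1 < size s')%N -> s'`_r'.+1 - s'`_0 != 0.
  by move=> us ss; rewrite subr_eq0 nth_uniq ?(leq_trans _ ss).
elim: r s => [|r IHr] s us ss.
  by move: (neq _ _ us ss); rewrite /= nth_behead => h; field.
have ub : uniq (behead s) by case: (s) us => //= ? ? /andP[].
have sb : (r.+1 < size (behead s))%N by rewrite size_behead; lia.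
rewrite divdiff_recS (IHr (behead s)) // (IHr s) //; last lia.
rewrite [divdiff_rec g r.+2 s]divdiff_recS.
have -> : divdiff_rec g r (behead (behead s)) =
    divdiff_rec g r.+1 (behead s) * ((behead s)`_r.+1 - (behead s)`_0)
    + divdiff_rec g r (behead s).
  by rewrite divdiff_recS mulfVK ?subrK // neq.
have h := neq _ _ us ss; rewrite !nth_behead.
move: (divdiff_rec g r.+1 (behead s)) (divdiff_rec g r.+1 s) => A B.
by field.
Qed.

(** A divided difference of order [r] reads off the coefficient of degree [r]
    of a polynomial of degree at most [r]; here the polynomial is monic and
    given by its roots, so that the Leibniz rule removes them one by one. *)
Lemma divdiff_rec_prod_sub (I : Type) (y : I -> R) (c : seq I) r s :
  uniq s -> (r < size s)%N -> (size c <= r)%N ->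
  divdiff_rec (fun t => \prod_(l <- c) (t - y l)) r s = (size c == r)%:R.
Proof.
elim: c r s => [|l c IHc] r s us ss sc.
  rewrite (@eq_divdiff_rec _ (fun=> 1)) => [|? _]; last by rewrite big_nil.
  by rewrite divdiff_rec1 eq_sym.
case: r => [//|r] in ss sc *.
have ub : uniq (behead s) by case: (s) us => //= ? ? /andP[].
rewrite (@eq_divdiff_rec _ (fun t => (t - y l) * \prod_(i <- c) (t - y i))).
  rewrite divdiff_rec_mul_sub // !IHc ?size_behead //; try by move: sc => /=; lia.
  rewrite (_ : size c == r.+1 = false) ?mulr0 ?add0r ?eqSS //.
  by move: sc => /=; lia.
by move=> i _; rewrite big_cons.
Qed.

End DividedDifferences.

(** * Evaluation of the functionals on the falling factorial basis *)

Section DesignPoints.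
Variables (R : realType) (n : nat) (x : nat -> R).
Hypothesis hx : forall i j : nat,
  (1 <= i)%N -> (i < j)%N -> (j <= n)%N -> x i < x j.

Lemma design_lt i j : (1 <= i <= n)%N -> (1 <= j <= n)%N ->
  (x i < x j) = (i < j)%N.
Proof.
move=> /andP[i1 iN] /andP[j1 jN]; case: (ltngtP i j) => [ij|ji|->].
- exact: hx.
- by apply/negbTE; rewrite -leNgt ltW // hx.
- exact: ltxx.
Qed.

Lemma design_uniq m N : (1 <= m)%N -> (m + N <= n.+1)%N ->
  uniq [seq x l | l <- iota m N].
Proof.
move=> m1 mN; rewrite map_inj_in_uniq ?iota_uniq // => i j.
rewrite !mem_iota => hi hj xij.
have := @design_lt i j; have := @design_lt j i; rewrite xij ltxx; lia.
Qed.

Lemma discrete_derivE d i f : (1 <= i < n)%N ->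
  discrete_deriv n x d f (x i.+1) =
  if (d <= i)%N then
    d`!%:R * divdiff_rec f d [seq x l | l <- iota (i - d).+1 d.+1]
  else i`!%:R * divdiff_rec f i [seq x l | l <- iota 1 i.+1].
Proof.
move=> hi; rewrite /discrete_deriv leNgt design_lt; [|lia..].
rewrite ifN; last lia.
have -> : [pick i0 : 'I_n.+1 | (1 <= i0)%N && (x i0 < x i.+1 <= x i0.+1)] =
    Some (inord i).
  case: pickP => [i0 /and3P[i01 lt1 le2]|/(_ (inord i))].
    congr Some; apply: val_inj; rewrite /= inordK; last lia.
    have i0n := ltn_ord i0.
    have {i0n} i0n : (i0 < n)%N.
      rewrite ltn_neqAle -ltnS i0n andbT; apply/eqP => i0E.
      by move: lt1; rewrite i0E design_lt; lia.
    move: lt1; rewrite design_lt; [|lia..] => lt1.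
    by move: le2; rewrite leNgt design_lt; lia.
  rewrite inordK; last lia.
  by rewrite lexx design_lt; lia.
rewrite inordK; last lia.
(* The evaluation point extends the block of nodes by one more design point. *)
have blockE p q : (p + q = i.+1)%N ->
    rcons [seq x l | l <- index_iota p i.+1] (x i.+1) =
    [seq x l | l <- iota p q.+1].
  by move=> pq; rewrite /index_iota -pq addKn -map_rcons -cats1 -addn1 iotaD.
case: ifP => di; rewrite /divdiff.
  by rewrite (@blockE _ d) ?size_map ?size_iota //; lia.
by rewrite (@blockE _ i) ?size_map ?size_iota //; lia.
Qed.

(** The factor [x_i - x_(i-k-1)] undoes the last division of the recursion,
    which leaves a difference over two overlapping blocks of [k+1] nodes; the
    last entry of the second list is the node dropped by the order [k]. *)
Lemma ff_dualE k i f : (1 <= i <= n)%N ->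
  ff_dual n x k i f =
  if (i <= k.+1)%N then
    i.-1`!%:R * divdiff_rec f i.-1 [seq x l | l <- iota 1 i]
  else k`!%:R * (divdiff_rec f k [seq x l | l <- iota (i - k) k.+1]
                 - divdiff_rec f k [seq x l | l <- iota (i - k.+1) k.+2]).
Proof.
case: i => [//|[|i]] hi; rewrite /ff_dual.
  by rewrite /discrete_deriv lexx /= mul1r.
rewrite !discrete_derivE; [|lia..].
case: (leqP i.+2 k.+1) => ik; first by rewrite ifN //; lia.
rewrite ifT; last lia.
have -> : ((i.+1 - k.+1).+1 = i.+2 - k.+1)%N by lia.
rewrite divdiff_recS (_ : behead _ = [seq x l | l <- iota (i.+2 - k) k.+1]).
  rewrite !(nth_map 0%N) ?size_iota // !nth_iota //.
  have -> : (i.+2 - k.+1 + k.+1 = i.+2)%N by lia.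
  rewrite addn0 factS natrM.
  have h : x i.+2 - x (i.+2 - k.+1)%N != 0.
    by rewrite gt_eqF // subr_gt0 design_lt; lia.
  have k1 : k.+1%:R != 0 :> R by rewrite pnatr_eq0.
  by move: (k.+1%:R) k1 => c c0; field; rewrite c0.
have -> : (i.+2 - k = (i.+2 - k.+1).+1)%N by lia.
by [].
Qed.

Lemma ff_basis_eq0 k i j : (1 <= i)%N -> (i < j <= n)%N ->
  ff_basis x k j (x i) = 0.
Proof.
move=> i1 ij; rewrite /ff_basis; case: ifP => jk.
  rewrite (bigD1_seq i) ?mem_index_iota ?iota_uniq //=; last lia.
  by rewrite subrr mul0r mulr0.
have -> : (x j.-1 < x i) = false by rewrite design_lt; lia.
by rewrite mulr0.
Qed.

(** On the roots [x_(j-k), ..., x_(j-1)], where the indicator vanishes, the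
    product does so as well. *)
Lemma ff_basisE k i j (q := minn j.-1 k) :
  (1 <= i <= n)%N -> (1 <= j <= n)%N -> (j - q <= i)%N ->
  ff_basis x k j (x i) = q`!%:R^-1 * \prod_(j - q <= l < j) (x i - x l).
Proof.
rewrite /ff_basis => hi hj ji; case: ifP => jk.
  have -> : q = j.-1 by rewrite /q; lia.
  by have -> : (j - j.-1 = 1)%N by lia.
have qk : q = k by rewrite /q; lia.
rewrite qk in ji *; rewrite design_lt; [|lia..].
case: ltnP => ij; first by rewrite mulr1.
rewrite mulr0 (bigD1_seq i) ?mem_index_iota ?iota_uniq //=; last lia.
by rewrite subrr mul0r mulr0.
Qed.

Lemma nth_design m N l : (l < N)%N ->
  [seq x p | p <- iota m N]`_l = x (m + l)%N.
Proof. by move=> lN; rewrite (nth_map 0%N) ?size_iota // nth_iota. Qed.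

Lemma divdiff_ff_basis_eq0 k j m r N :
  (1 <= m)%N -> (r < N)%N -> (m + r < j <= n)%N ->
  divdiff_rec (ff_basis x k j) r [seq x l | l <- iota m N] = 0.
Proof.
move=> m1 rN mj; rewrite -[RHS](divdiff_rec0 r [seq x l | l <- iota m N]).
by apply: eq_divdiff_rec => l lr; rewrite nth_design ?ff_basis_eq0 //; lia.
Qed.

Lemma divdiff_ff_basis k j m r N (q := minn j.-1 k) :
  (1 <= m)%N -> (r < N)%N -> (m + N <= n.+1)%N -> (1 <= j <= n)%N ->
  (j - q <= m)%N -> (q <= r)%N ->
  divdiff_rec (ff_basis x k j) r [seq x l | l <- iota m N] =
  q`!%:R^-1 * (q == r)%:R.
Proof.
move=> m1 rN mN hj jm qr.
rewrite (@eq_divdiff_rec _ _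
  (fun t => q`!%:R^-1 * \prod_(l <- index_iota (j - q) j) (t - x l))); last first.
  by move=> l lr; rewrite nth_design ?ff_basisE -/q //; lia.
have size_roots : size (index_iota (j - q) j) = q.
  by rewrite size_iota /q; lia.
rewrite divdiff_recZ divdiff_rec_prod_sub ?size_roots //.
  exact: design_uniq.
by rewrite size_map size_iota.
Qed.

Lemma ff_dual_linear k i c f g : (1 <= i <= n)%N ->
  ff_dual n x k i (fun t => c * f t + g t)
  = c * ff_dual n x k i f + ff_dual n x k i g.
Proof.
by move=> hi; rewrite !ff_dualE // !divdiff_recP; case: ifP => _; ring.
Qed.

Lemma eq_ff_dual k i f g : (1 <= i <= n)%N ->
  (forall l, (1 <= l <= n)%N -> f (x l) = g (x l)) ->
  ff_dual n x k i f = ff_dual n x k i g.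
Proof.
move=> hi fg; rewrite !ff_dualE //.
have eq_block m r N : (1 <= m)%N -> (r < N)%N -> (m + r <= n)%N ->
    divdiff_rec f r [seq x l | l <- iota m N] =
    divdiff_rec g r [seq x l | l <- iota m N].
  by move=> *; apply: eq_divdiff_rec => l lr; rewrite nth_design ?fg //; lia.
case: ifP => ik; first by rewrite eq_block //; lia.
by congr (_ * (_ - _)); apply: eq_block; lia.
Qed.

Lemma ff_dual_basis k i j : (1 <= i <= n)%N -> (1 <= j <= n)%N ->
  ff_dual n x k i (ff_basis x k j) = (i == j)%:R.
Proof.
have fact_neq0 p : p`!%:R != 0 :> R by rewrite pnatr_eq0 -lt0n fact_gt0.
move=> hi hj; rewrite ff_dualE //; case: ifP => ik.
  have [ij|ji] := ltnP i j.
    by rewrite divdiff_ff_basis_eq0 ?mulr0 ?ltn_eqF //; lia.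
  have qE : minn j.-1 k = j.-1 by lia.
  rewrite divdiff_ff_basis ?qE //; try lia.
  have -> : (j.-1 == i.-1) = (i == j) by lia.
  by case: eqP => [->|_]; rewrite ?mulr0 // mulr1 mulfV.
have [ij|ji] := ltnP i j.
  by rewrite !divdiff_ff_basis_eq0 ?subrr ?mulr0 ?ltn_eqF //; lia.
rewrite divdiff_ff_basis //; try lia.
case: (ltngtP i j) ji => // [ji _|ij _]; last first.
  have qE : minn j.-1 k = k by lia.
  by rewrite divdiff_ff_basis_eq0 ?qE ?eqxx ?subr0 ?mulr1 ?mulfV //; lia.
by rewrite divdiff_ff_basis ?subrr ?mulr0 //; lia.
Qed.

End DesignPoints.

Theorem lemma6 (R : realType) (a b : R) (k n : nat) (x : nat -> R)
  (hn : (k.+1 <= n)%N)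
  (hax : a <= x 1%N)
  (hx : forall i j : nat, (1 <= i)%N -> (i < j)%N -> (j <= n)%N -> x i < x j)
  (hxb : x n <= b)
  (hxn1 : x n.+1 = b) :
  [/\ (* each ff_dual n x k i is a linear functional ... *)
      forall i : nat, (1 <= i <= n)%N ->
        forall (c : R) (f g : R -> R),
          ff_dual n x k i (fun t => c * f t + g t)
          = c * ff_dual n x k i f + ff_dual n x k i g,
      (* ... on functions on [a, b] ... *)
      forall i : nat, (1 <= i <= n)%N ->
        forall f g : R -> R,
          (forall t : R, a <= t <= b -> f t = g t) ->
          ff_dual n x k i f = ff_dual n x k i g
    & (* ... and together they are dual to the falling factorial basis *)
      forall i j : nat, (1 <= i <= n)%N -> (1 <= j <= n)%N ->
        ff_dual n x k i (ff_basis x k j) = if i == j then 1 else 0].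
Proof.
split=> [i hi c f g|i hi f g fg|i j hi hj].
- exact: ff_dual_linear.
- apply: eq_ff_dual => // l hl; apply: fg.
  have le_x p q : (1 <= p)%N -> (p <= q <= n)%N -> x p <= x q.
    by move=> p1 pq; rewrite leNgt (design_lt hx) -?leqNgt; lia.
  apply/andP; split; first by rewrite (le_trans hax) // le_x; lia.
  by rewrite (le_trans _ hxb) // le_x; lia.
- by rewrite ff_dual_basis //; case: (i == j).
Qed.
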